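(* Let $G=(V,E)$ be a (possibly nonconnected) graph with no isolated vertex, and let $\Omega$ be a verification operator of the graph state $|G\rangle$ based on Pauli measurements. For each $j\in V$ let $p_j^X$, $p_j^Y$, $p_j^Z$ be the probability that $X$, $Y$, and $Z$ measurements, respectively, are performed on the $j$th qubit. Then $$\beta(\Omega)\geq \max_{j\in V}\max\{p_j^X,p_j^Y,p_j^Z\}\geq \frac13,\qquad \nu(\Omega)\leq \frac23 .$$ If $\nu(\Omega)=2/3$ or $\beta(\Omega)=1/3$, then $p_j^X=p_j^Y=p_j^Z=1/3$ for all $j\in V$.
   Context: Graphs are finite and simple, with vertex set $V=\{1,\dots,n\}$. The graph state $|G\rangle\in(\mathbb{C}^2)^{\otimes n}$ is the unique (up to phase) unit vector that is a common $+1$ eigenvector of the operators $S_j=X_j\prod_{k:\{j,k\}\in E}Z_k$, $j=1,\dots,n$, where $X_j,Y_j,Z_j$ are the Pauli matrices acting on qubit $j$. A test operator for $|G\rangle$ is an operator $E$ with $0\le E\le \mathbb{1}$ and $E|G\rangle=|G\rangle$; a verification operator is a finite convex combination $\Omega=\sum_kp_kE_k$ of test operators ($p_k\ge 0$, $\sum_kp_k=1$), where $p_k$ is the probability of performing the $k$th test. $\beta(\Omega)$ is the second largest eigenvalue of $\Omega$ (counted with multiplicity; the largest is $1$, attained at $|G\rangle$), and $\nu(\Omega)=1-\beta(\Omega)$ is the spectral gap. A Pauli measurement (setting) $\mu$ on $n$ qubits specifies for each qubit either one of the Pauli measurements $X,Y,Z$ or the trivial measurement (identity). Its outcome projectors are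 the tensor products over the qubits of an eigenprojector of the measured Pauli operator (or of the identity, for qubits where the measurement is trivial). A test operator is based on $\mu$ if it is a linear combination of the outcome projectors of $\mu$. The verification operator $\Omega=\sum_kp_kE_k$ is based on Pauli measurements if each $E_k$ is based on some Pauli measurement $\mu_k$; the probability $p_j^X$ (respectively $p_j^Y$, $p_j^Z$) is then the sum of $p_k$ over all $k$ for which $\mu_k$ measures $X$ (respectively $Y$, $Z$) on qubit $j$.
   Formalization: The inequality max_j max{p_j^X,p_j^Y,p_j^Z} ≥ 1/3 fails if all measurements are trivial (Ω = identity), so it is stated only when some qubit has a nontrivial Pauli measurement in every test of positive probability; β ≥ 1/3, ν ≤ 2/3 and the equality case are unconditional. *)

(* Defs.v *)
From HB Require Import structures.
From mathcomp Require Import all_boot all_order all_algebra.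
From mathcomp Require Import reals complex.

Set Implicit Arguments.
Unset Strict Implicit.
Unset Printing Implicit Defensive.

Import Order.TTheory GRing.Theory Num.Theory.
Local Open Scope ring_scope.
Local Open Scope sesquilinear_scope.
Local Open Scope complex_scope.

(* The computational basis of (C^2)^{(x) n} consists of the bit strings
   {ffun 'I_n -> 'I_2}; vectors and operators are written in coordinates
   with respect to that basis, enumerated by enum_val. *)
Definition hdim (n : nat) : nat := #|{: {ffun 'I_n -> 'I_2}}|.

Definition bits (n : nat) (x : 'I_(hdim n)) : {ffun 'I_n -> 'I_2} :=
  enum_val x.

Definition tensor (R : realType) (n : nat) (A : 'I_n -> 'M[R[i]]_2) :
    'M[R[i]]_(hdim n) :=
  \matrix_(x, y) \prod_(j < n) A j (bits x j) (bits y j).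

Inductive pauli : Type := PauliX | PauliY | PauliZ.

Lemma pauli_comparable : comparable pauli.
Proof. by move=> a b; rewrite /decidable; decide equality. Defined.

HB.instance Definition _ :=
  hasDecEq.Build pauli (compareP pauli_comparable).

Definition pauli_mx (R : realType) (P : pauli) : 'M[R[i]]_2 :=
  match P with
  | PauliX => \matrix_(a, b) (a != b)%:R
  | PauliY => \matrix_(a, b)
                (if a == b then 0 else if a == ord0 then 0 -i* 1 else 0 +i* 1)
  | PauliZ => \matrix_(a, b) (if a == b then (-1) ^+ a else 0)
  end.

Definition pauli_at (R : realType) (n : nat) (P : pauli) (j : 'I_n) :
    'M[R[i]]_(hdim n) :=
  tensor (fun k => if k == j then pauli_mx R P else 1%:M).

Definition stabilizer_gen (R : realType) (n : nat) (e : rel 'I_n) (j : 'I_n) :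
    'M[R[i]]_(hdim n) :=
  pauli_at R PauliX j *m \prod_(k < n | e j k) pauli_at R PauliZ k.

(* The graph state is determined up to phase, so it is specified by its
   defining property rather than by the choice of a representative. *)
Definition is_graph_state (R : realType) (n : nat) (e : rel 'I_n)
    (psi : 'cV[R[i]]_(hdim n)) : Prop :=
  psi ^t* *m psi = 1%:M /\ forall j, stabilizer_gen R e j *m psi = psi.

(* In the order of R[i], 0 <= z means that z is real and nonnegative. *)
Definition psdmx (R : realType) (N : nat) (A : 'M[R[i]]_N) : Prop :=
  A \is hermsymmx /\ forall v : 'cV[R[i]]_N, 0 <= (v ^t* *m A *m v) ord0 ord0.

Definition is_test_operator (R : realType) (n : nat)
    (psi : 'cV[R[i]]_(hdim n)) (E : 'M[R[i]]_(hdim n)) : Prop :=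
  [/\ psdmx E, psdmx (1%:M - E) & E *m psi = psi].

(* None stands for the trivial measurement. *)
Definition setting (n : nat) : Type := 'I_n -> option pauli.

(* The projector (1 + (-1)^s P) / 2. The identity has the single
   eigenprojector 1, so s is irrelevant for a trivial measurement. *)
Definition eigenproj (R : realType) (a : option pauli) (s : bool) :
    'M[R[i]]_2 :=
  if a is Some P then 2^-1 *: (1%:M + (-1) ^+ s *: pauli_mx R P) else 1%:M.

Definition outcome_proj (R : realType) (n : nat) (mu : setting n)
    (o : {ffun 'I_n -> bool}) : 'M[R[i]]_(hdim n) :=
  tensor (fun j => eigenproj R (mu j) (o j)).

Definition based_on (R : realType) (n : nat) (E : 'M[R[i]]_(hdim n))
    (mu : setting n) : Prop :=
  exists c : {ffun 'I_n -> bool} -> R[i],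
    E = \sum_(o : {ffun 'I_n -> bool}) c o *: outcome_proj R mu o.

Definition mixture (R : realType) (n m : nat) (p : 'I_m -> R)
    (E : 'I_m -> 'M[R[i]]_(hdim n)) : 'M[R[i]]_(hdim n) :=
  \sum_(k < m) (p k)%:C *: E k.

Definition prob_measured (R : realType) (n m : nat) (p : 'I_m -> R)
    (mu : 'I_m -> setting n) (P : pauli) (j : 'I_n) : R :=
  \sum_(k < m | mu k j == Some P) p k.

(* The neutral element 0 is harmless: the probabilities are nonnegative. *)
Definition max_prob (R : realType) (n m : nat) (p : 'I_m -> R)
    (mu : 'I_m -> setting n) : R :=
  \big[Num.max/0]_(j < n)
    Num.max (prob_measured p mu PauliX j)
      (Num.max (prob_measured p mu PauliY j) (prob_measured p mu PauliZ j)).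

(* Eigenvalues with algebraic multiplicity, as the roots of the
   characteristic polynomial, in no particular order. *)
Definition eigenvalues (R : realType) (N : nat) (A : 'M[R[i]]_N) : seq R[i] :=
  sval (closed_field_poly_normal (char_poly A)).

(* The eigenvalues of a Hermitian operator are real, so that taking real
   parts only changes their type. *)
Definition beta (R : realType) (N : nat) (A : 'M[R[i]]_N) : R :=
  nth 0 (sort >=%R (map (@complex.Re R) (eigenvalues A))) 1.

Definition nu (R : realType) (N : nat) (A : 'M[R[i]]_N) : R := 1 - beta A.

(* Main.v *)
(* If P is a Pauli operator on qubit j, some stabilizer generator anticommutes
   with it because j is not isolated, so phi = P psi is a unit vector
   orthogonal to psi. Every test whose setting measures P, or nothing, on j
   commutes with P and hence fixes phi. The Rayleigh quotient of Omega at phi is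
   therefore at least the total probability of these tests, and so is beta.
   Counting the trivial measurement for each of X, Y and Z, the three
   probabilities sum to 1 + 2 p(trivial), whence 1/3 and the equality case. *)
Require Import Defs.
From mathcomp Require Import all_boot all_order all_algebra.
From mathcomp Require Import reals complex lra.

Import Order.TTheory GRing.Theory Num.Theory.
Local Open Scope ring_scope.
Local Open Scope sesquilinear_scope.

Set Implicit Arguments.
Unset Strict Implicit.
Unset Printing Implicit Defensive.

(** * Adjoints of complex matrices *)

Lemma trmxC_mul (C : numClosedFieldType) (m n p : nat)
    (A : 'M[C]_(m, n)) (B : 'M[C]_(n, p)) :
  (A *m B) ^t* = B ^t* *m A ^t*.
Proof. by rewrite trmx_mul map_mxM. Qed.

Lemma hermsymmxP (C : numClosedFieldType) (n : nat) (A : 'M[C]_n) :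
  reflect (A ^t* = A) (A \is hermsymmx).
Proof.
by apply: (iffP (is_hermitianmxP _ _ _)); rewrite expr0 scale1r => /esym.
Qed.

Lemma trmxCE (C : numClosedFieldType) (m n : nat) (A : 'M[C]_(m, n)) i j :
  (A ^t*) i j = (A j i)^*.
Proof. by rewrite !mxE. Qed.

Lemma trmxC_self_mul (C : numClosedFieldType) (n : nat) (v : 'cV[C]_n) :
  (v ^t* *m v) ord0 ord0 = \sum_i `|v i ord0| ^+ 2.
Proof.
by rewrite mxE; apply: eq_bigr => i _; rewrite !mxE mulrC normCK.
Qed.

Lemma bits_bij (n : nat) : bijective (@bits n).
Proof. exact: enum_val_bij. Qed.

(** * Algebra of tensor products of one-qubit matrices *)

Section Tensor.
Variables (R : realType) (n : nat).
Implicit Types A B : 'I_n -> 'M[R[i]]_2.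

Lemma eq_tensor A B : A =1 B -> tensor A = tensor B.
Proof.
by move=> eqAB; apply/matrixP=> x y; rewrite !mxE; apply: eq_bigr => j _; rewrite eqAB.
Qed.

(** An entry of the product is a sum over bit strings of products over qubits; distributivity turns
    it into a product over qubits of sums over one bit. *)
Lemma tensor_mul A B : tensor A *m tensor B = tensor (fun j => A j *m B j).
Proof.
apply/matrixP=> x y; rewrite !mxE.
under [RHS]eq_bigr do rewrite mxE.
rewrite bigA_distr_bigA /=.
rewrite [RHS](reindex (@bits n)) /=; last exact/onW_bij/bits_bij.
by apply: eq_bigr => z _; rewrite !mxE -big_split.
Qed.

Lemma tensor1 : tensor (fun=> 1%:M) = 1%:M :> 'M[R[i]]_(hdim n).
Proof.
apply/matrixP=> x y; rewrite !mxE -(bij_eq (bits_bij n)).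
have [->|neq] := eqVneq (bits x) (bits y).
  by apply: big1 => j _; rewrite mxE eqxx.
have /existsP[j neqj] : [exists j, bits x j != bits y j].
  apply: contraR neq => /existsPn eqb; apply/eqP/ffunP => j.
  by apply/eqP/negPn/eqb.
by rewrite (bigD1 j) //= mxE (negPf neqj) mul0r.
Qed.

Lemma tensor_scale (c : 'I_n -> R[i]) A :
  tensor (fun j => c j *: A j) = (\prod_j c j) *: tensor A.
Proof.
apply/matrixP=> x y; rewrite !mxE -big_split /=.
by apply: eq_bigr => j _; rewrite mxE.
Qed.

Lemma tensor_trmxC A : (tensor A) ^t* = tensor (fun j => (A j) ^t*).
Proof.
apply/matrixP=> x y; rewrite !mxE rmorph_prod.
by apply: eq_bigr => j _; rewrite !mxE.
Qed.

(** Away from [j] the Pauli factor is the identity, so [c] arises at site [j] alone. Used with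
    [c = -1] for stabilizer generators and [c = 1] for outcome projectors. *)
Lemma pauli_at_tensor_comm P j A c :
    pauli_mx R P *m A j = c *: (A j *m pauli_mx R P) ->
  pauli_at R P j *m tensor A = c *: (tensor A *m pauli_at R P j).
Proof.
move=> comm; rewrite !tensor_mul.
have -> : c = \prod_(k < n) (if k == j then c else 1).
  by rewrite -big_mkcond big_pred1_eq.
rewrite -tensor_scale; apply: eq_tensor => k.
by case: eqVneq => [->//|_]; rewrite mul1mx mulmx1 scale1r.
Qed.

Lemma prod_pauli_at P (r : seq 'I_n) : uniq r ->
  \prod_(k <- r) pauli_at R P k =
    tensor (fun k => if k \in r then pauli_mx R P else 1%:M).
Proof.
elim: r => [_|k r IH /= /andP[knr /IH IHr]].
  by rewrite big_nil -[LHS]/(1%:M) -tensor1; apply: eq_tensor => k; rewrite in_nil.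
rewrite big_cons {}IHr [LHS]tensor_mul; apply: eq_tensor => l.
rewrite in_cons; case: eqVneq => [->|_] /=; last by rewrite mul1mx.
by rewrite (negPf knr) mulmx1.
Qed.

(** Irreflexivity keeps [j] out of the product of [Z] factors, so that [X] stands alone on qubit
    [j]. *)
Lemma stabilizer_gen_tensor (e : rel 'I_n) j : irreflexive e ->
  stabilizer_gen R e j =
    tensor (fun k => if k == j then pauli_mx R PauliX
                     else if e j k then pauli_mx R PauliZ else 1%:M).
Proof.
move=> irr; rewrite /stabilizer_gen -big_filter prod_pauli_at; last first.
  by rewrite filter_uniq // index_enum_uniq.
rewrite tensor_mul; apply: eq_tensor => k.
rewrite mem_filter mem_index_enum andbT.
by case: eqVneq => [->|_]; rewrite ?irr ?mulmx1 ?mul1mx.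
Qed.

End Tensor.

(** * One-qubit Pauli matrices *)

Section Pauli.
Variable R : realType.

(** Serves as an eliminator, so that identities of 2 by 2 matrices are checked entry by entry. *)
Lemma ord2P (P : 'I_2 -> Prop) : P ord0 -> P ord_max -> forall k, P k.
Proof.
move=> P0 P1 [[|[|//]] k2]; first by rewrite (_ : Ordinal _ = ord0) //; exact: val_inj.
by rewrite (_ : Ordinal _ = ord_max) //; exact: val_inj.
Qed.

Local Open Scope complex_scope.

Lemma pauli_mx_trmxC (P : pauli) : (pauli_mx R P) ^t* = pauli_mx R P.
Proof.
apply/matrixP; elim/ord2P; elim/ord2P; case: P; rewrite !mxE /=;
  rewrite ?expr0 ?expr1 ?rmorphN1 ?rmorph0 ?rmorph1 //;
  by apply/eqP; rewrite eq_complex /= ?oppr0 ?opprK !eqxx.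
Qed.

Lemma pauli_mx_sq (P : pauli) : pauli_mx R P *m pauli_mx R P = 1%:M.
Proof.
apply/matrixP; elim/ord2P; elim/ord2P; case: P;
  rewrite !mxE !big_ord_recl big_ord0 !mxE /=;
  apply/eqP; rewrite eq_complex /=;
  by rewrite !(mulr0, mul0r, addr0, add0r, oppr0, mulrN, mulNr, mulr1, mul1r,
               opprK) !eqxx.
Qed.

Lemma pauli_mx_anticomm (P Q : pauli) : P != Q ->
  pauli_mx R P *m pauli_mx R Q = - 1 *: (pauli_mx R Q *m pauli_mx R P).
Proof.
move=> neq; apply/matrixP; elim/ord2P; elim/ord2P; case: P Q neq; case=> // _;
  rewrite !mxE !big_ord_recl !big_ord0 !mxE /=;
  apply/eqP; rewrite eq_complex /=;
  by rewrite !(mulr0, mul0r, addr0, add0r, oppr0, mulrN, mulNr, mulr1, mul1r,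
               opprK) !eqxx.
Qed.

Lemma pauli_eigenproj_comm (P : pauli) (a : option pauli) s :
    a = None \/ a = Some P ->
  pauli_mx R P *m eigenproj R a s = eigenproj R a s *m pauli_mx R P.
Proof.
case=> -> /=; first by rewrite mulmx1 mul1mx.
by rewrite -scalemxAr -scalemxAl mulmxDr mulmxDl mulmx1 mul1mx -scalemxAr -scalemxAl.
Qed.

End Pauli.

(** * Single-qubit Paulis against stabilizer generators and tests *)

Section PauliAt.
Variables (R : realType) (n : nat).

Lemma pauli_at_sq P (j : 'I_n) : pauli_at R P j *m pauli_at R P j = 1%:M.
Proof.
rewrite tensor_mul -tensor1; apply: eq_tensor => k.
by case: eqP => _; rewrite ?pauli_mx_sq ?mulmx1.
Qed.

Lemma stabilizer_gen_trmxC (e : rel 'I_n) j : irreflexive e ->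
  (stabilizer_gen R e j) ^t* = stabilizer_gen R e j.
Proof.
move=> irr; rewrite stabilizer_gen_tensor // tensor_trmxC.
apply: eq_tensor => k; case: eqP => _; first exact: pauli_mx_trmxC.
by case: (e j k); rewrite ?pauli_mx_trmxC // trmx1 map_mx1.
Qed.

Lemma stabilizer_anticomm (e : rel 'I_n) P j :
    symmetric e -> irreflexive e -> (exists k, e j k) ->
  exists l, pauli_at R P j *m stabilizer_gen R e l =
              - 1 *: (stabilizer_gen R e l *m pauli_at R P j).
Proof.
(* The generator at [j] has [X] on qubit [j], which anticommutes with [Z]; the generator at a
   neighbour has [Z] there, which anticommutes with [X] and [Y]. *)
move=> sym irr [k ejk]; exists (if P == PauliZ then j else k).
rewrite stabilizer_gen_tensor //; apply: pauli_at_tensor_comm.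
have [->|nZ] := eqVneq P PauliZ; first by rewrite eqxx; exact: pauli_mx_anticomm.
have -> : (j == k) = false by apply/eqP => jk; rewrite jk irr in ejk.
by rewrite sym ejk; exact: pauli_mx_anticomm.
Qed.

(** The anticommuting generator fixes [psi] on either side; moving it across the Pauli operator
    shows that the expectation value equals its own negative. *)
Lemma graph_state_pauli_orthogonal (e : rel 'I_n) (psi : 'cV[R[i]]_(hdim n)) P j :
    symmetric e -> irreflexive e -> (exists k, e j k) ->
    is_graph_state e psi ->
  psi ^t* *m (pauli_at R P j *m psi) = 0.
Proof.
move=> sym irr nis [_ stab].
have [l anti] := stabilizer_anticomm P sym irr nis.
have stabl : psi ^t* *m stabilizer_gen R e l = psi ^t*.
  by rewrite -{2}(stab l) trmxC_mul stabilizer_gen_trmxC.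
have opp : psi ^t* *m (pauli_at R P j *m psi) = - (psi ^t* *m (pauli_at R P j *m psi)).
  rewrite -{2}(stab l) (mulmxA (pauli_at R P j)) anti -scalemxAl scaleN1r mulmxN.
  by rewrite -mulmxA (mulmxA (psi ^t*)) stabl.
apply/matrixP=> a b; have /matrixP/(_ a b) := opp.
by rewrite [X in _ = X -> _]mxE => /esym/eqP; rewrite eqNr => /eqP ab0; rewrite ab0 mxE.
Qed.

Lemma based_on_pauli_comm (E : 'M[R[i]]_(hdim n)) (mu : setting n) P j :
    based_on E mu -> mu j = None \/ mu j = Some P ->
  pauli_at R P j *m E = E *m pauli_at R P j.
Proof.
move=> [c ->] muj; rewrite mulmx_sumr mulmx_suml; apply: eq_bigr => o _.
rewrite -scalemxAr -scalemxAl; congr (_ *: _).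
rewrite -[RHS]scale1r; apply: pauli_at_tensor_comm.
by rewrite scale1r; exact: pauli_eigenproj_comm.
Qed.

End PauliAt.

(** * Lower bounds on the second largest eigenvalue *)

Section Beta.
Local Open Scope complex_scope.

Lemma char_poly_similar (F : fieldType) (n : nat) (P A B : 'M[F]_n) :
  P \in unitmx -> P *m A = B *m P -> char_poly A = char_poly B.
Proof.
rewrite unitmxE unitfE => nzP PA.
have nzP' : \det (map_mx (polyC (R:=F)) P) != 0 by rewrite det_map_mx polyC_eq0.
apply: (mulfI nzP'); rewrite [RHS]mulrC -!det_mulmx; congr (\det _).
by rewrite mulmxBr mulmxBl -!map_mxM PA scalar_mxC.
Qed.

(** The spectral theorem makes [A] similar to a diagonal matrix; equal characteristic polynomials
    then have the same roots with multiplicity. *)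
Lemma perm_eigenvalues (R : realType) (n : nat) (A : 'M[R[i]]_n) :
  A \is hermsymmx ->
  perm_eq (eigenvalues A) [seq spectral_diag A ord0 i | i <- enum 'I_n].
Proof.
move=> /hermitian_normalmx/orthomx_spectralP specA.
rewrite /eigenvalues; case: closed_field_poly_normal => r /=.
rewrite (monicP (char_poly_monic A)) scale1r => charA.
apply: prod_XsubC_eq; rewrite -{}charA big_map big_enum /=.
rewrite (@char_poly_similar _ _ (spectralmx A) A (diag_mx (spectral_diag A))).
- rewrite char_poly_trig ?diag_mx_is_trig //.
  by apply: eq_bigr => i _; rewrite mxE eqxx mulr1n.
- exact: spectral_unit.
by rewrite {2}specA !mulmxA mulmxV ?mul1mx ?spectral_unit.
Qed.

Lemma beta_ge (R : realType) (n : nat) (A : 'M[R[i]]_n) (t : R) (i j : 'I_n) :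
    A \is hermsymmx -> i != j ->
    t%:C <= spectral_diag A ord0 i -> t%:C <= spectral_diag A ord0 j ->
  t <= beta A.
Proof.
move=> hermA neq ti tj; rewrite /beta.
(* The list decreases, so it is sorted for the dual order; its entry 1 is at least [t] once two
   entries are, and [i] and [j] supply them. *)
apply: (@nth_count_le _ R^d) => /=.
  by apply: sort_sorted => x y; exact: ge_total.
rewrite count_sort count_map (permP (perm_eigenvalues hermA)) count_map.
rewrite -size_filter enumT.
have -> (a : pred 'I_n) : size (filter a (Finite.enum 'I_n)) = #|a|.
  by rewrite cardE /enum_mem.
apply/card_gt1P; exists i, j.
by move: ti tj; rewrite !unfold_in /= !lecE => /andP[_ ?] /andP[_ ?].
Qed.

(* Otherwise 1 would be the only eigenvalue that is at least t, with
   eigenspace spanned by psi, and A would be smaller than t on its orthogonal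
   complement. *)
Lemma beta_ge_rayleigh (R : realType) (n : nat) (A : 'M[R[i]]_n) (t : R)
    (psi phi : 'cV[R[i]]_n) :
    A \is hermsymmx -> t <= 1 ->
    A *m psi = psi -> psi != 0 -> psi ^t* *m phi = 0 -> phi != 0 ->
    t%:C * (phi ^t* *m phi) ord0 ord0 <= (phi ^t* *m A *m phi) ord0 ord0 ->
  t <= beta A.
Proof.
move=> hermA t1 Apsi psi0 orth phi0 ray.
pose U := spectralmx A; pose d := spectral_diag A.
have unitU : U \in unitmx := spectral_unit A.
have UU : U ^t* *m U = 1%:M.
  by rewrite -invmx_unitary ?spectral_unitarymx // mulVmx.
have specA : A = U ^t* *m diag_mx d *m U.
  rewrite -invmx_unitary ?spectral_unitarymx //.
  exact/orthomx_spectralP/hermitian_normalmx.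
(* Coordinates of [psi] and [phi] in an orthonormal eigenbasis of [A]. *)
pose a := U *m psi; pose b := U *m phi.
have UA : U *m A = diag_mx d *m U.
  rewrite [in LHS]specA -invmx_unitary ?spectral_unitarymx //.
  by rewrite !mulmxA mulmxV ?mul1mx.
have da k : d ord0 k * a k ord0 = a k ord0.
  have: (diag_mx d *m a) k ord0 = a k ord0.
    by rewrite /a mulmxA -UA -mulmxA Apsi.
  by rewrite mul_diag_mx mxE.
have ab : a ^t* *m b = 0.
  by rewrite trmxC_mul mulmxA -(mulmxA _ _ U) UU mulmx1.
have Uinj (v : 'cV[R[i]]_n) : v != 0 -> exists k, (U *m v) k ord0 != 0.
  move=> v0; apply/existsP; apply: contraR v0 => /existsPn z.
  rewrite -(mulKmx unitU v); have -> : U *m v = 0; last by rewrite mulmx0.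
  by apply/matrixP=> k l; rewrite ord1 [RHS]mxE; apply/eqP/negPn/z.
have [i ai] := Uinj _ psi0.
have di : d ord0 i = 1 by apply: (mulIf ai); rewrite da mul1r.
(* The order of [R[i]] is partial: negating [t <= d j] yields [d j < t] only between real
   numbers. *)
have tR : t%:C \is Num.real by rewrite complex_real.
have dR k : d ord0 k \is Num.real.
  exact: (mxOverP (hermitian_spectral_diag_real hermA)).
have [/existsP[j /andP[ji tj]]|/existsPn small] :=
    boolP [exists j, (j != i) && (t%:C <= d ord0 j)].
  by apply: (beta_ge hermA ji tj); rewrite -/d di lecR.
have {}small j : j != i -> d ord0 j < t%:C.
  by move=> ji; have := small j; rewrite ji /= real_ltNge.
(* Off [i] the eigenvalues are below [t <= 1], hence differ from 1, so [psi] lives on coordinate [i]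
   alone. Orthogonality then kills that coordinate of [phi]. *)
have a0 j : j != i -> a j ord0 = 0.
  move=> /small dj; apply/eqP; have /eqP := da j.
  rewrite -subr_eq0 -{2}(mul1r (a j ord0)) -mulrBl mulf_eq0 => /orP[|//].
  by rewrite subr_eq0 => /eqP dj1; move: dj; rewrite dj1 ltcR ltNge t1.
have bi : b i ord0 = 0.
  have /matrixP/(_ ord0 ord0) := ab.
  rewrite mxE [X in _ = X -> _]mxE (bigD1 i) //= big1 => [|j ji].
    by rewrite trmxCE addr0 => /eqP; rewrite mulf_eq0 conjC_eq0 (negPf ai) => /eqP.
  by rewrite trmxCE a0 // conjC0 mul0r.
have gap k : 0 <= (t%:C - d ord0 k) * `|b k ord0| ^+ 2.
  have [->|ki] := eqVneq k i; first by rewrite bi normr0 expr0n mulr0.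
  by rewrite mulr_ge0 ?exprn_ge0 // subr_ge0 ltW // small.
(* The sum is the Rayleigh deficit of [phi]: nonnegative term by term, nonpositive by [ray]. All
   terms thus vanish, although a nonzero coordinate of [phi] makes one strictly positive. *)
have sum0 : \sum_k (t%:C - d ord0 k) * `|b k ord0| ^+ 2 = 0.
  apply/le_anti; rewrite sumr_ge0 ?andbT //.
  have -> : \sum_k (t%:C - d ord0 k) * `|b k ord0| ^+ 2 =
      t%:C * (phi ^t* *m phi) ord0 ord0 - (phi ^t* *m A *m phi) ord0 ord0.
    have -> : phi ^t* *m phi = b ^t* *m b.
      by rewrite trmxC_mul mulmxA -(mulmxA _ _ U) UU mulmx1.
    have -> : phi ^t* *m A *m phi = b ^t* *m (diag_mx d *m b).
      by rewrite trmxC_mul [in LHS]specA !mulmxA.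
    rewrite trmxC_self_mul mulr_sumr mxE -sumrB; apply: eq_bigr => k _.
    rewrite mulrBl mul_diag_mx trmxCE [X in _ = _ - _ * X]mxE normCK.
    by congr (_ - _); rewrite [RHS]mulrC mulrA.
  by rewrite subr_le0 ray.
have [k bk] := Uinj _ phi0.
have ki : k != i by apply: contraNneq bk => ->; rewrite -/b bi.
have /eqP := @psumr_eq0P _ _ xpredT _ (fun k _ => gap k) sum0 k isT.
rewrite mulf_eq0 expf_eq0 normr_eq0 (negPf bk) orbF subr_eq0 => /eqP tk.
by have := small k ki; rewrite tk ltxx.
Qed.

End Beta.

(** * Mixtures of tests and their measurement probabilities *)

Section Mixture.
Variables (R : realType) (n m : nat).
Local Open Scope complex_scope.

Lemma mixture_hermitian (p : 'I_m -> R) (E : 'I_m -> 'M[R[i]]_(hdim n)) :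
  (forall k, E k \is hermsymmx) -> mixture p E \is hermsymmx.
Proof.
move=> hermE; apply/hermsymmxP; rewrite /mixture !raddf_sum /=.
apply: eq_bigr => k _; rewrite linearZ map_mxZ /=.
by rewrite (hermsymmxP _ (hermE k)); congr (_ *: _); exact: conjc_real.
Qed.

(* The trivial measurement on qubit j may be counted as a measurement of P. *)
Lemma prob_compatible_le_beta (e : rel 'I_n) (psi : 'cV[R[i]]_(hdim n))
    (p : 'I_m -> R) (E : 'I_m -> 'M[R[i]]_(hdim n)) (mu : 'I_m -> setting n) P j :
    symmetric e -> irreflexive e -> (exists k, e j k) ->
    is_graph_state e psi ->
    (forall k, 0 <= p k) -> \sum_(k < m) p k = 1 ->
    (forall k, is_test_operator psi (E k)) ->
    (forall k, based_on (E k) (mu k)) ->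
  \sum_(k < m | (mu k j == None) || (mu k j == Some P)) p k
    <= beta (mixture p E).
Proof.
move=> sym irr nis gs p0 p1 testE basedE.
pose phi := pauli_at R P j *m psi.
have psi0 : psi != 0.
  apply/eqP => z; have [/matrixP/(_ ord0 ord0)/eqP] := gs.
  by rewrite z mulmx0 !mxE eq_sym oner_eq0.
have phi0 : phi != 0.
  apply: contraNneq psi0 => z.
  by rewrite -(mul1mx psi) -(pauli_at_sq R P j) -mulmxA -/phi z mulmx0.
apply: (beta_ge_rayleigh (psi := psi) (phi := phi)) => //.
- by apply: mixture_hermitian => k; case: (testE k) => -[].
- rewrite -p1 [leRHS](bigID (fun k => (mu k j == None) || (mu k j == Some P))).
  by rewrite lerDl sumr_ge0.
- rewrite /mixture mulmx_suml -[RHS]scale1r -[1](rmorph1 (real_complex R)) -p1.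
  rewrite rmorph_sum scaler_suml; apply: eq_bigr => k _.
  by rewrite -scalemxAl; case: (testE k) => _ _ ->.
- exact: graph_state_pauli_orthogonal gs.
(* The comparison is made test by test: compatible tests fix [phi] and give equality, the others
   contribute a nonnegative term. *)
rewrite rmorph_sum mulr_suml /mixture mulmx_sumr mulmx_suml summxE /=.
rewrite big_mkcond; apply: ler_sum => k _.
rewrite -scalemxAr -scalemxAl [leRHS]mxE; case: ifP => [muk|_]; last first.
  by apply: mulr_ge0; [rewrite ler0c | case: (testE k) => -[]].
have Ephi : E k *m phi = phi.
  rewrite mulmxA -(based_on_pauli_comm (P := P) (j := j) (basedE k)).
    by rewrite -mulmxA; case: (testE k) => _ _ ->.
  by case/orP: muk => /eqP; [left | right].
by rewrite -mulmxA Ephi.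
Qed.

Lemma sum_compatible (p : 'I_m -> R) (mu : 'I_m -> setting n) P j :
  \sum_(k < m | (mu k j == None) || (mu k j == Some P)) p k =
    \sum_(k < m | mu k j == None) p k + prob_measured p mu P j.
Proof.
rewrite [LHS]big_mkcond [X in X + _]big_mkcond [X in _ + X]big_mkcond -big_split.
by apply: eq_bigr => k _; case: (mu k j) => [Q|] /=; rewrite ?add0r ?addr0.
Qed.

Lemma sum_prob_measured (p : 'I_m -> R) (mu : 'I_m -> setting n) j :
  \sum_(k < m | mu k j == None) p k + prob_measured p mu PauliX j
    + prob_measured p mu PauliY j + prob_measured p mu PauliZ j
  = \sum_(k < m) p k.
Proof.
rewrite /prob_measured [X in X + _ + _ + _]big_mkcond.
rewrite [X in _ + X + _ + _]big_mkcond [X in _ + _ + X + _]big_mkcond.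
rewrite [X in _ + _ + _ + X]big_mkcond -!big_split; apply: eq_bigr => k _ /=.
by case: (mu k j) => [[]|]; rewrite ?add0r ?addr0.
Qed.

End Mixture.

Theorem theorem3 (R : realType) (n : nat) (e : rel 'I_n)
    (psi : 'cV[R[i]]_(hdim n)) (m : nat) (p : 'I_m -> R)
    (E : 'I_m -> 'M[R[i]]_(hdim n)) (mu : 'I_m -> setting n)
    (Omega : 'M[R[i]]_(hdim n)) :
  (0 < n)%N ->
  symmetric e -> irreflexive e -> (forall j, exists k, e j k) ->
  is_graph_state e psi ->
  (forall k, 0 <= p k) -> \sum_(k < m) p k = 1 ->
  (forall k, is_test_operator psi (E k)) ->
  (forall k, based_on (E k) (mu k)) ->
  Omega = mixture p E ->
  [/\ max_prob p mu <= beta Omega,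
      (exists j, forall k, 0 < p k -> mu k j <> None) ->
        1 / 3 <= max_prob p mu,
      1 / 3 <= beta Omega,
      nu Omega <= 2 / 3
    & nu Omega = 2 / 3 \/ beta Omega = 1 / 3 ->
      forall j, [/\ prob_measured p mu PauliX j = 1 / 3,
                    prob_measured p mu PauliY j = 1 / 3
                  & prob_measured p mu PauliZ j = 1 / 3]].
Proof.
move=> n0 sym irr nis gs p0 p1 testE basedE ->.
pose t P j := prob_measured p mu P j.
pose none j := \sum_(k < m | mu k j == None) p k.
have none0 j : 0 <= none j by apply: sumr_ge0.
have t0 P j : 0 <= t P j by apply: sumr_ge0.
have tot j : none j + t PauliX j + t PauliY j + t PauliZ j = 1.
  by rewrite -p1 -(sum_prob_measured p mu j).
have le_beta P j : none j + t P j <= beta (mixture p E).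
  rewrite -sum_compatible.
  exact: prob_compatible_le_beta sym irr (nis j) gs p0 p1 testE basedE.
have beta3 : 1 / 3 <= beta (mixture p E).
  (* The three bounds at any one vertex add up to [3 * beta >= 1 + 2 * none j]. *)
  pose j := Ordinal n0; move: (tot j) (none0 j).
  by move: (le_beta PauliX j) (le_beta PauliY j) (le_beta PauliZ j); lra.
have t_le_beta P j : t P j <= beta (mixture p E).
  by apply: le_trans (le_beta P j); rewrite lerDr.
split=> //.
(* The neutral element 0 must also lie below beta, which [beta3] ensures. *)
- apply: bigmax_le => [|j _]; first by apply: le_trans beta3; lra.
  by rewrite !ge_max !t_le_beta.
- move=> [j measured].
  (* Settings trivial on [j] have probability 0, so the three probabilities at [j] sum to 1 and one
     of them reaches 1/3. *)
  have nonej : none j = 0.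
    apply: big1 => k /eqP muk; apply/eqP; have := p0 k.
    by rewrite le_eqVlt eq_sym => /orP[//|/measured].
  have := le_bigmax 0 (fun j => Num.max (t PauliX j)
            (Num.max (t PauliY j) (t PauliZ j))) j.
  rewrite -/(max_prob p mu) !ge_max => /and3P[].
  by move: (tot j); rewrite nonej; lra.
- by rewrite /nu; lra.
move=> betaE j.
have {}betaE : beta (mixture p E) = 1 / 3 by case: betaE; rewrite /nu; lra.
(* With beta equal to 1/3 the added bounds force [none j = 0]; three numbers at most 1/3 with sum 1
   are then all 1/3. *)
move: (tot j) (none0 j).
move: (le_beta PauliX j) (le_beta PauliY j) (le_beta PauliZ j).
by rewrite betaE -!/(t _ j) => *; split; lra.
Qed.
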